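(* No compact graph is $\omega$-saturated. Moreover, no open graph on a compact space is $\omega$-saturated.
   Context: All topological spaces are assumed to be Hausdorff. A graph is a pair $(V,E)$ where $E$ is a symmetric and reflexive binary relation on $V$ (every vertex has a loop). A graph on a topological space $X$ (i.e. with vertex set $X$) is called compact if its edge relation is a compact subset of $X^2$; it is called open if its edge relation with the diagonal removed, $\{(x,y)\in E: x\neq y\}$, is an open subset of $X^2$ without the diagonal. A graph $G$ is $\omega$-saturated if for all disjoint finite sets $A,B\subseteq G$ there exists $v\in G\setminus(A\cup B)$ adjacent to all elements of $A$ and to no element of $B$. *)

(* Defs.v *)
From mathcomp Require Import all_boot all_order all_algebra.
From mathcomp Require Import all_classical all_reals all_analysis.

Set Implicit Arguments.
Unset Strict Implicit.
Unset Printing Implicit Defensive.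

Local Open Scope classical_set_scope.

Record loop_graph (V : Type) := LoopGraph {
  edges : set (V * V) ;
  edges_refl : forall x, edges (x, x) ;
  edges_sym : forall x y, edges (x, y) -> edges (y, x) }.

Definition compact_graph (X : topologicalType) (G : loop_graph X) : Prop :=
  compact (edges G).

Definition off_diagonal (X : Type) : set (X * X) := [set p | p.1 <> p.2].

(* In [subspace A] the points outside A are isolated, so a subset of A is open
   there iff it is relatively open in A. *)
Definition open_graph (X : topologicalType) (G : loop_graph X) : Prop :=
  open (edges G `&` @off_diagonal X : set (subspace (@off_diagonal X))).

Definition omega_saturated (V : Type) (G : loop_graph V) : Prop :=
  forall A B : set V, finite_set A -> finite_set B -> A `&` B = set0 ->
  exists v : V, [/\ ~ (A `|` B) v,
    forall a, A a -> edges G (v, a) &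
    forall b, B b -> ~ edges G (v, b)].

(* Main.v *)
Require Import Defs.
From mathcomp Require Import all_boot all_order all_algebra.
From mathcomp Require Import all_classical all_reals all_analysis.

(** In a compact graph the neighbourhoods of the vertices are closed subsets of
    a compact space; by saturation they have the finite intersection property,
    so some vertex v is adjacent to every vertex. No vertex is then nonadjacent
    to v, contradicting saturation for B = {v}. The open case is dual: the sets
    of vertices that are equal or nonadjacent to a given one are closed, which
    yields a vertex v without neighbours other than itself, contradicting
    saturation for A = {v}. *)

Local Open Scope classical_set_scope.

(* [compact_In0] is only available over pointed spaces. *)
Lemma compact_closed_fip {X : topologicalType} {I : Type} (N : I -> set X) :
  compact [set: X] -> (forall i, closed (N i)) ->
  (forall A : set I, finite_set A -> \bigcap_(i in A) N i !=set0) ->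
  \bigcap_i N i !=set0.
Proof.
move=> cX clN fipN.
pose F := filter_from finite_set (fun A : set I => \bigcap_(i in A) N i).
have FF : ProperFilter F.
  apply: filter_from_proper => //; apply: filter_from_filter.
    by exists set0.
  move=> A B finA finB; exists (A `|` B); first by rewrite finite_setU.
  by rewrite bigcap_setU.
(* A cluster point of the filter generated by the finite intersections lies in the closure of every
   [N i]. *)
have [v [_ clv]] := cX F FF filterT.
exists v => i _; apply: clN => U Uv.
have FNi : F (N i) by exists [set i] => //; rewrite bigcap_set1.
exact: clv FNi Uv.
Qed.

(** Thanks to the loops, the first projection maps the edge set onto all of [X]. *)
Lemma compact_graph_space {X : topologicalType} {G : loop_graph X} :
  compact_graph G -> compact [set: X].
Proof.
move=> cG; rewrite (_ : [set: X] = fst @` edges G).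
  by apply: continuous_compact => //; apply: continuous_subspaceT => p;
    exact: cvg_fst.
by apply/seteqP; split=> // x _; exists (x, x) => //; exact: edges_refl.
Qed.

(** The edges ending at [a] form a closed part of a compact set, so their first projection is
    compact, hence closed in a Hausdorff space. *)
Lemma compact_graph_closed_nbhd {X : topologicalType} {G : loop_graph X} (a : X) :
  hausdorff_space X -> compact_graph G -> closed [set v | edges G (v, a)].
Proof.
move=> hX cG; apply: compact_closed => //.
rewrite (_ : [set v | _] = fst @` (edges G `&` snd @^-1` [set a])).
  apply: continuous_compact.
    by apply: continuous_subspaceT => p; exact: cvg_fst.
  apply: compact_closedI => //; apply: preimage_closed.
    by move=> p _; exact: cvg_snd.
  exact: (accessible_closed_set1 (hausdorff_accessible hX)).
apply/seteqP; split=> [v Gva|_ [[v b] [Gvb /= <-] <-]//].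
by exists (v, a).
Qed.

(** Off the diagonal the edges agree with an open [V] of the full product; the set is the slice of
    [V] at [a] minus the closed point [a]. *)
Lemma open_graph_open_nbhd {X : topologicalType} {G : loop_graph X} (a : X) :
  hausdorff_space X -> open_graph G -> open [set v | v <> a /\ edges G (v, a)].
Proof.
move=> hX /open_subspaceP[V oV VE].
rewrite (_ : [set v | _] = ~` [set a] `&` (fun v => (v, a)) @^-1` V).
  apply: openI.
    apply: closed_openC.
    exact: (accessible_closed_set1 (hausdorff_accessible hX)).
  apply: open_comp => // v _.
  by apply: cvg_pair; [exact: cvg_id|exact: cvg_cst].
apply/seteqP; split=> v /= [va Gva]; split=> //.
  suff [] : (V `&` off_diagonal (X:=X)) (v, a) by [].
  by rewrite VE.
have : (V `&` off_diagonal (X:=X)) (v, a) by [].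
by rewrite VE => -[[]].
Qed.

Theorem corollary2p7 (X : topologicalType) (hX : hausdorff_space X)
    (G : loop_graph X) :
  (compact_graph G -> ~ omega_saturated G) /\
  (compact [set: X] -> open_graph G -> ~ omega_saturated G).
Proof.
split=> [cG|cX oG] satG.
- have [|A finA|v Gv] := compact_closed_fip (fun a => [set v | edges G (v, a)])
    (compact_graph_space cG).
  + by move=> a; exact: compact_graph_closed_nbhd.
  + have [v [_ Gv _]] := satG A set0 finA (finite_set0 _) (setI0 _).
    by exists v.
  + have [w [_ _ Gw]] := satG set0 [set v] (finite_set0 _) (finite_set1 _) (set0I _).
    by apply: (Gw v) => //; apply: edges_sym; exact: Gv.
- have [|B finB|v Gv] := compact_closed_fip
    (fun b => ~` [set v | v <> b /\ edges G (v, b)]) cX.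
  + by move=> b; apply: open_closedC; exact: open_graph_open_nbhd.
  + have [v [_ _ Gv]] := satG set0 B (finite_set0 _) finB (set0I _).
    by exists v => b /Gv nGvb [_ /nGvb].
  (* Saturation picks [w] outside [[set v]], so its edge to [v] is not the loop. *)
  + have [w [wv Gw _]] := satG [set v] set0 (finite_set1 _) (finite_set0 _) (setI0 _).
    apply: (Gv w) => //; split; last exact/edges_sym/Gw.
    by move=> vw; apply: wv; left.
Qed.
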